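(* Let $E=\bigsqcup_{n\in\omega}E_n$ be a continuous signature and let $X$ be a topological $E$-algebra with structure maps $\mathfrak e^X_n\colon E_n\times X^n\to X$. If $E$ is $C$-universal and $X^n$ is pseudocompact for every $n\in\mathrm{Sp}\,E$, then the operations of $X$ extend to continuous operations on $\beta X$ (that is, each $\mathfrak e^X_n$ extends to a continuous map $E_n\times(\beta X)^n\to\beta X$), with respect to which $\beta X$ is a topological $E$-algebra.
   Context: All spaces are Tychonoff; $\beta X$ is the Stone–Čech compactification. A continuous signature is a space $E$ that is the disjoint union of clopen (possibly empty) subsets $E_n$, $n\in\omega=\{0,1,2,\dots\}$; $\mathrm{Sp}\,E=\{n\in\omega: E_n\ne\varnothing\}$. An $E$-algebra is a set $X$ with maps $\mathfrak e^X_n\colon E_n\times X^n\to X$, $n\in\omega$ ($X^0$ is a singleton). A topological $E$-algebra is an $E$-algebra endowed with a topology making all $\mathfrak e^X_n$ continuous. A pair of spaces $(S,T)$ is a $C$-pair if every continuous function $S\times T\to\mathbb R$ has a continuous extension $\beta S\times T\to\mathbb R$. A space $T$ is $C$-universal if $(S,T)$ is a $C$-pair for every pseudocompact space $S$. *)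

(* Defs.v *)
(* The real line is an arbitrary [R : realType]. *)
From HB Require Import structures.
From mathcomp Require Import all_boot all_order all_algebra.
From mathcomp Require Import all_classical all_reals all_analysis.
Import Order.TTheory GRing.Theory Num.Theory numFieldNormedType.Exports.

Set Implicit Arguments.
Unset Strict Implicit.
Unset Printing Implicit Defensive.

Local Open Scope classical_set_scope.
Local Open Scope ring_scope.

Definition tychonoff_space (T : topologicalType) : Prop :=
  hausdorff_space T /\ completely_regular_space T.

(* The product topology; [power X 0] is a singleton. *)
Definition power (X : topologicalType) (n : nat) : topologicalType :=
  {ptws 'I_n -> X}.

(* The Stone-Cech compactification is the closure of the image of X in the
   cube indexed by all continuous functions X -> [0, 1]. The factors are
   copies of R rather than of [0, 1], which does not change the closure. *)
Section StoneCech.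
Variables (R : realType) (X : topologicalType).

Definition unit_functions : set (X -> R) :=
  [set f : X -> R | continuous f /\ forall x, 0 <= f x <= 1].

Definition sc_cube : topologicalType := {ptws set_type unit_functions -> R}.

Definition sc_eval (x : X) : sc_cube := fun f => set_val f x.

Definition stone_cech : topologicalType :=
  set_type (closure (range sc_eval)).

Lemma sc_eval_closure (x : X) : sc_eval x \in closure (range sc_eval).
Proof. by apply/mem_set/subset_closure; exists x. Qed.

Definition sc_unit (x : X) : stone_cech :=
  exist (fun p => p \in closure (range sc_eval)) (sc_eval x)
    (sc_eval_closure x).

End StoneCech.
Arguments unit_functions : clear implicits.

(* [stone_cech R X] is compact Hausdorff; [sc_unit] is a dense embedding when
   X is Tychonoff, along which continuous functions X -> [0, 1] extend. *)
Section StoneCechTheory.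
Variables (R : realType) (X : topologicalType).
Local Notation bX := (stone_cech R X).
Local Notation eta := (@sc_unit R X).

Lemma sc_unit_continuous : continuous eta.
Proof.
apply: continuous_comp_initial => x; apply/cvg_sup => i.
move: x; apply/(@continuousP _ (initial_topology (@^~ i))) => _ [B oB <-].
have [+ _] := set_valP i => /continuousP/(_ _ oB).
by congr open; apply/seteqP; split.
Qed.

Lemma sc_proj_continuous (i : unit_functions R X) :
  continuous (fun p : bX => set_val p i).
Proof.
move=> p.
apply: (@continuous_comp _ _ _ (set_val : bX -> sc_cube R X)
  (proj i : sc_cube R X -> R)).
  exact: initial_continuous.
exact: proj_continuous.
Qed.

Lemma stone_cech_hausdorff : hausdorff_space bX.
Proof.
move=> p q pq; apply/val_inj/functional_extensionality_dep => i.
apply: (@Rhausdorff R) => A B Ap Bq.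
have [r [Ar Br]] := pq _ _ (sc_proj_continuous Ap) (sc_proj_continuous Bq).
by exists (set_val r i).
Qed.

Lemma stone_cech_compact : compact [set: bX].
Proof.
pose Q : set (sc_cube R X) := [set p | forall i, `[0%R, 1%R]%classic (p i)].
have cQ : compact Q.
  by apply: (@tychonoff _ (fun=> R) (fun=> `[0%R, 1%R]%classic)) => _;
     exact: segment_compact.
have hQ : hausdorff_space (sc_cube R X).
  by apply: (@hausdorff_product _ (fun=> R)) => _; exact: Rhausdorff.
have sQ : closure (range (@sc_eval R X)) `<=` Q.
  rewrite [X in _ `<=` X](closure_id _).1; last exact: compact_closed.
  apply: closureS => _ [x _ <-] i.
  by have [_ /(_ x)] := set_valP i; rewrite /= in_itv.
have cC := subclosed_compact (@closed_closure _ _) cQ sQ.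
move=> F FF _; pose G := fmap (set_val : bX -> sc_cube R X) F.
have GC : G (closure (range (@sc_eval R X))).
  by apply: (@filterS _ F _ setT _ _ filterT) => q _; exact: set_valP.
have [p [Cp Gp]] := cC G (fmap_proper_filter _ FF) GC.
exists (exist _ p (mem_set Cp)); split => // B N FB.
rewrite nbhsE => -[_ [[V oV <-] Vp] VN].
have GB : G (set_val @` B).
  by apply: (@filterS _ F _ B) => // q Bq; exists q.
have [_ [[q Bq <-] Vq]] := Gp _ _ GB (open_nbhs_nbhs (conj oV Vp)).
by exists q; split => //; exact: VN.
Qed.

Lemma stone_cech_tychonoff : tychonoff_space bX.
Proof.
split; first exact: stone_cech_hausdorff.
apply: (@normal_completely_regular R).
- exact: (compact_normal stone_cech_hausdorff stone_cech_compact).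
- exact/hausdorff_accessible/stone_cech_hausdorff.
Qed.

Lemma sc_unit_dense : closure (range eta) = [set: bX].
Proof.
apply/seteqP; split => // p _ N; rewrite nbhsE => -[_ [[V oV <-] Vp] VN].
have [_ [[x _ <-] Vx]] := set_valP p V (open_nbhs_nbhs (conj oV Vp)).
by exists (eta x); split; [exists x | exact: VN].
Qed.

Lemma sc_unit_separates (x : X) (B : set X) : completely_regular_space X ->
  closed B -> ~ B x ->
  exists2 V : set bX, open V & V (eta x) /\ eta @^-1` V `<=` ~` B.
Proof.
move=> crX cB nBx; have sep := crX _ _ cB nBx.
pose u := Urysohn [set x] B : X -> R.
have uP : unit_functions R X u.
  split; first exact: Urysohn_continuous.
  by move=> y; have := @Urysohn_range _ R [set x] B (u y);
    rewrite /= in_itv; apply; exists y.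
pose i : unit_functions R X := exist _ u (mem_set uP).
exists ((fun p : bX => set_val p i) @^-1` [set r | r < 1]).
  apply: open_comp; last exact: open_lt.
  by move=> p _; exact: sc_proj_continuous.
split=> [|y] /=.
  have : (u @` [set x]) (u x) by exists x.
  move=> /(Urysohn_sub0 sep) /= ux0.
  by suff : u x < 1 by []; rewrite ux0 ltr01.
move=> uy1 By.
have /(Urysohn_sub1 sep)/= uyE : (u @` B) (u y) by exists y.
by have : u y < 1 by []; rewrite uyE ltxx.
Qed.

Lemma sc_unit_inj : tychonoff_space X -> injective eta.
Proof.
move=> [hX crX] x y exy; apply: contrapT => xy.
have [|V _ [Vx /(_ y)]] :=
    @sc_unit_separates x [set y] crX _ xy.
  by apply: accessible_closed_set1; exact: hausdorff_accessible.
by rewrite /= -exy => /(_ Vx); apply.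
Qed.

Lemma sc_unit_open (U : set X) : tychonoff_space X -> open U ->
  exists2 V : set bX, open V & U = eta @^-1` V.
Proof.
move=> [_ crX] oU.
exists (\bigcup_(V in [set V : set bX | open V /\ eta @^-1` V `<=` U]) V).
  by apply: bigcup_open => V [].
apply/seteqP; split => [x Ux|x [V [_ +]]]; last exact.
have [|V oV [Vx VU]] := @sc_unit_separates x (~` U) crX (open_closedC oU).
  exact.
by exists V => //; split => // y /VU /contrapT.
Qed.

Lemma sc_extend (f : X -> R) : continuous f -> (forall x, 0 <= f x <= 1) ->
  exists2 g : bX -> R, continuous g & forall x, g (eta x) = f x.
Proof.
move=> cf f01; pose i : unit_functions R X := exist _ f (mem_set (conj cf f01)).
by exists (fun p => set_val p i) => //; exact: sc_proj_continuous.
Qed.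

End StoneCechTheory.

Section Pseudocompact.
Variable R : realType.

Definition pseudocompact_space (S : topologicalType) : Prop :=
  forall f : S -> R, continuous f -> bounded_fun f.

Definition C_pair (S T : topologicalType) : Prop :=
  forall f : S * T -> R, continuous f ->
    exists2 g : stone_cech R S * T -> R, continuous g &
      forall s t, g (sc_unit R s, t) = f (s, t).

Definition C_universal (T : topologicalType) : Prop :=
  forall S : topologicalType,
    tychonoff_space S -> pseudocompact_space S -> C_pair S T.

End Pseudocompact.

Section Algebras.
Variables (E : topologicalType) (En : nat -> set E).

Definition continuous_signature : Prop :=
  [/\ forall n, clopen (En n), trivIset [set: nat] En &
      \bigcup_n En n = [set: E]].

Definition Sp : set nat := [set n | En n !=set0].

Definition algebra_operations (X : topologicalType) : Type :=
  forall n, set_type (En n) * power X n -> X.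

Definition topological_algebra (X : topologicalType)
    (e : algebra_operations X) : Prop :=
  forall n, continuous (e n).

Definition extends_operations (X Y : topologicalType) (i : X -> Y)
    (e : algebra_operations X) (e' : algebra_operations Y) : Prop :=
  forall n (a : set_type (En n)) (x : power X n),
    e' n (a, i \o x) = i (e n (a, x)).

End Algebras.

(* Main.v *)
(* A map from a dense subset of a space Z to X extends to a continuous map
   Z -> beta X as soon as every continuous u : X -> [0, 1] composed with it has
   arbitrarily small oscillation near each point of Z. For Z = E_n x (beta X)^n
   and f = u o e_n this is checked in two steps. Since E is C-universal,
   f extends to E_n x beta(X^n), and compactness of beta(X^n) makes
   a |-> f(a, .) continuous for the sup norm. For fixed a, the function f(a, .)
   on X^n has small oscillation near each point of (beta X)^n: this is the
   content of Glicksberg's theorem beta(X^n) = (beta X)^n for pseudocompact X^n,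
   and it is proved one coordinate at a time. *)
Require Import Defs.
From mathcomp Require Import all_boot all_order all_algebra.
From mathcomp Require Import all_classical all_reals all_analysis.
From mathcomp Require Import lra.
Import Order.TTheory GRing.Theory Num.Theory numFieldNormedType.Exports.

Set Implicit Arguments.
Unset Strict Implicit.
Unset Printing Implicit Defensive.

Local Open Scope classical_set_scope.
Local Open Scope ring_scope.

(** * Finite powers: boxes and changes of one coordinate *)

Lemma ptws_continuous (I : choiceType) (T X : topologicalType)
    (f : T -> {ptws I -> X}) :
  (forall i, continuous (fun t => f t i)) -> continuous f.
Proof.
move=> cf t; apply/cvg_sup => i.
move: t; apply/(@continuousP _ (initial_topology (@^~ i))) => _ [B oB <-].
by have /continuousP/(_ _ oB) := cf i; congr open; apply/seteqP; split.
Qed.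

Section Power.
Variables (X : topologicalType) (n : nat).
Implicit Types z w : power X n.

Lemma nbhs_box z (N : 'I_n -> set X) : (forall i, nbhs (z i) (N i)) ->
  nbhs z [set w : power X n | forall i, N i (w i)].
Proof.
move=> Nz.
pose f i : set (power X n) := [set w | N i (w i)].
apply: (@filter_forall (power X n) 'I_n f (nbhs z)) => i.
exact: (@proj_continuous _ (fun=> X) i z _ (Nz i)).
Qed.

Lemma nbhs_powerP z (A : set (power X n)) : nbhs z A ->
  exists2 N : 'I_n -> set X, (forall i, nbhs (z i) (N i)) &
    forall w, (forall i, N i (w i)) -> A w.
Proof.
pose F : set_system (power X n) :=
  filter_from [set N : 'I_n -> set X | forall i, nbhs (z i) (N i)]
    (fun N => [set w | forall i, N i (w i)]).
have FF : Filter F.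
  apply: filter_from_filter; first by exists (fun=> setT) => i; exact: filterT.
  move=> N M Nz Mz; exists (fun i => N i `&` M i).
    by move=> i; exact: filterI.
  by move=> w NMw; split => i; have [] := NMw i.
(* The product topology is a supremum of initial topologies, so convergence of the filter of boxes
   is tested one coordinate at a time, with all other sides full. *)
suff Fz : F --> z by move=> /Fz [N Nz NA]; exists N.
apply/cvg_sup => i U [_ [[V oV <-] Vz] VU].
apply: filterS VU _.
exists (fun j => if j == i then V else setT).
  move=> j /=; case: eqP => [->|_]; last exact: filterT.
  exact: open_nbhs_nbhs.
by move=> w /(_ i); rewrite eqxx.
Qed.

Definition upd (i : 'I_n) z (x : X) : power X n :=
  fun j => if j == i then x else z j.

Lemma upd_continuous i : continuous (fun p : power X n * X => upd i p.1 p.2).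
Proof.
apply: ptws_continuous => j; rewrite /upd; case: eqP => [_|_] p.
  exact: cvg_snd.
apply: (@continuous_comp _ _ _ fst (fun z : power X n => z j)).
  exact: cvg_fst.
exact: (@proj_continuous _ (fun=> X)).
Qed.

Lemma upd_continuousr i z : continuous (upd i z).
Proof.
apply: ptws_continuous => j; rewrite /upd; case: eqP => [_|_] x.
  exact: cvg_id.
exact: cvg_cst.
Qed.

Lemma upd_id i z : upd i z (z i) = z.
Proof. by apply/funext => j; rewrite /upd; case: eqP => [->|]. Qed.

Lemma upd_upd i z (x y : X) : upd i (upd i z x) y = upd i z y.
Proof. by apply/funext => j; rewrite /upd; case: eqP. Qed.

Lemma updE i z (x : X) : upd i z x i = x.
Proof. by rewrite /upd eqxx. Qed.

(** Replaces the coordinates of [z] by those of [w] one at a time without leaving the box; each of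
    the [n] replacements costs at most [d]. The sides [N i] are arbitrary sets, so that one of them
    may be a singleton. *)
Lemma telescope (R : numDomainType) (f : power X n -> R)
    (N : 'I_n -> set X) (d : R) :
  (forall i z x, N i (z i) -> N i x -> `|f z - f (upd i z x)| <= d) ->
  forall z w, (forall i, N i (z i)) -> (forall i, N i (w i)) ->
    `|f z - f w| <= d *+ n.
Proof.
move=> fd z w Nz Nw.
pose h k : power X n := fun j => if (j < k)%N then w j else z j.
suff H k : (k <= n)%N -> `|f z - f (h k)| <= d *+ k.
  have -> : w = h n by apply/funext => j; rewrite /h ltn_ord.
  exact: H.
elim: k => [_|k IH kn].
  by have -> : h 0%N = z; [exact/funext|rewrite subrr normr0 mulr0n].
have -> : h k.+1 = upd (Ordinal kn) (h k) (w (Ordinal kn)).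
  apply/funext => j; rewrite /h /upd -(inj_eq val_inj) /= ltnS leq_eqVlt.
  case: eqP => //= jk; congr w; exact: val_inj.
rewrite -(subrK (f (h k)) (f z)) -addrA mulrSr.
apply: le_trans (ler_normD _ _) (lerD (IH (ltnW kn)) _).
by apply: fd; [rewrite /h ltnn|].
Qed.

End Power.

(** * Complete regularity and pseudocompactness *)

Lemma power_tychonoff (R : realType) (X : topologicalType) (n : nat) :
  tychonoff_space X -> tychonoff_space (power X n).
Proof.
move=> [hX crX]; split; first exact: (@hausdorff_product _ (fun=> X)).
(* A completely regular topology comes from a uniformity; a product of uniform spaces is uniform,
   hence completely regular. *)
pose X' := @completely_regular_uniformity.type R X crX.
exact: (@uniform_completely_regular R {ptws 'I_n -> X'}).
Qed.

Lemma bump (R : realType) (Z : topologicalType) (z : Z) (O : set Z) (c : R) :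
  completely_regular_space Z -> open O -> O z -> 0 <= c ->
  exists g : Z -> R, [/\ continuous g, forall w, 0 <= g w,
    forall w, ~ O w -> g w = 0 & g z = c].
Proof.
move=> crZ oO Oz c0.
have /(@uniform_separatorP _ R)[u [cu u01 uz uO]] :
  uniform_separator [set z] (~` O) by apply: crZ => //; exact: open_closedC.
exists (fun w => c * (1 - u w)); split.
- move=> w; apply: cvgM; first exact: cvg_cst.
  by apply: cvgB; [exact: cvg_cst|exact: cu].
- move=> w; have /= := u01 (u w) (ex_intro2 _ _ w I erefl).
  by rewrite in_itv /= => /andP[_ uw]; rewrite mulr_ge0 // subr_ge0.
- by move=> w Ow; rewrite (uO (u w)) ?subrr ?mulr0 //; exists w.
- by rewrite (uz (u z)) ?subr0 ?mulr1 //; exists z.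
Qed.

(* If the sets were locally finite, a sum of bump functions of heights
   0, 1, 2, ... supported in them would be continuous and unbounded. *)
Lemma pseudocompact_cluster (R : realType) (Z : topologicalType)
    (O : nat -> set Z) :
  completely_regular_space Z -> pseudocompact_space R Z ->
  (forall k, open (O k)) -> (forall k, O k !=set0) ->
  exists z : Z, forall N : set Z, nbhs z N -> forall k, exists2 m, (k <= m)%N &
    N `&` O m !=set0.
Proof.
move=> crZ pcZ oO O0; apply: contrapT => nocluster.
have locfin (z : Z) : exists NK : set Z * nat, nbhs z NK.1 /\
    forall m w, (NK.2 <= m)%N -> NK.1 w -> ~ O m w.
  apply: contrapT => Hz; apply: nocluster; exists z => N Nz k.
  apply: contrapT => Hk; apply: Hz; exists (N, k); split => // m w km Nw Omw.
  by apply: Hk; exists m => //; exists w.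
have [NK NKP] := choice locfin => {locfin nocluster}.
pose N z := (NK z).1; pose K z := (NK z).2.
have [p pO] := choice O0.
have [g gP] := choice (fun m => @bump R Z (p m) (O m) m%:R crZ (oO m) (pO m)
  (ler0n _ _)).
pose S M z := \sum_(m < M) g m z.
(* On [N z] all terms from index [K z] on vanish, so [G] is the full infinite sum and coincides
   there with the finite sum [S (K z)]. *)
pose G z := S (K z) z.
have SE z w M : N z w -> (K z <= M)%N -> S M w = S (K z) w.
  move=> Nzw KM; rewrite /S -!(big_mkord xpredT (fun m => g m w)).
  rewrite (big_cat_nat (leq0n _) KM) /= [X in _ + X]big_nat.
  rewrite [X in _ + X]big1 ?addr0 // => m /andP[Km _].
  have [_ _ + _] := gP m; apply.
  by have [_ /(_ m w Km Nzw)] := NKP z.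
have Nxx z : N z z by apply: nbhs_singleton; have [] := NKP z.
have GS z w : N z w -> G w = S (K z) w.
  move=> Nzw; rewrite /G -(@SE w w (maxn (K z) (K w))) ?leq_maxr //.
  by rewrite (@SE z) ?leq_maxl.
have cS M : continuous (S M).
  apply: continuous_big => [|m _]; first exact: add_continuous.
  by have [] := gP m.
have cG : continuous G.
  move=> z; have := cS (K z) z; rewrite /continuous_at -(GS z z (Nxx z)).
  apply: cvg_trans; apply: near_eq_cvg.
  by have [Nz _] := NKP z; apply: filterS Nz => w /GS.
have Gp m : m%:R <= G (p m).
  (* Since [p m] lies in [O m], the truncation defining [G (p m)] retains the term of index [m],
     whose value there is [m]. *)
  have pm : ~ (K (p m) <= m)%N.
    by move=> Km; have [_ /(_ m (p m) Km (Nxx _))] := NKP (p m); apply.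
  have {}pm : (m < K (p m))%N by rewrite ltnNge; apply/negP.
  rewrite /G /S (bigD1 (Ordinal pm)) //=.
  have [_ _ _ ->] := gP m; rewrite lerDl sumr_ge0 // => i _.
  by have [_ + _ _] := gP i; apply.
have [M [_ /(_ (`|M| + 1) _)/= GM]] := pcZ G cG.
have {}GM : forall z, `|G z| <= `|M| + 1.
  by move=> z; apply: GM => //; rewrite (le_lt_trans (ler_norm M)) ?ltrDl.
have := truncnS_gt (`|M| + 1); rewrite ltNge => /negP; apply.
exact: le_trans (Gp _) (le_trans (ler_norm _) (GM _)).
Qed.

(** Splits an error among [n] coordinates; dividing by [n.+1] also covers [n = 0]. *)
Lemma divr_mulrn_le (R : realFieldType) (n : nat) (e : R) :
  0 <= e -> e / n.+1%:R *+ n <= e.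
Proof.
move=> e0; rewrite -mulr_natr -mulrA ler_piMr // mulrC.
by rewrite ler_pdivrMr ?ltr0n // mul1r ler_nat.
Qed.

(** * Oscillation of a function on a pseudocompact power *)

Section Oscillation.
Variables (R : realType) (X : topologicalType) (n : nat).
Local Notation eta := (@sc_unit R X).
Variable f : power X n -> R.
Hypotheses (crX : completely_regular_space (power X n))
  (pcX : pseudocompact_space R (power X n)) (cf : continuous f).
Implicit Types (z u : power X n) (i : 'I_n).

(* Otherwise iterating the negation gives open sets [O k] and decreasing
   members [s k] of [F] with [O k] over [s k] and the difference at least [e]
   on [O k] and [s k.+1]; it is then also large near a cluster point of the
   [O k], contradicting continuity there. *)
Lemma oscillation (F : set_system X) i (e : R) : Filter F -> 0 < e ->
  exists2 W, F W & forall (O : set (power X n)) W', open O -> O !=set0 ->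
    (forall u, O u -> W (u i)) -> F W' ->
    exists u x, [/\ O u, W' x & `|f u - f (upd i u x)| < e].
Proof.
move=> FF e0; apply: contrapT => Hn.
pose sT := {W : set X | F W}.
have step (s : sT) : exists p : set (power X n) * sT,
    [/\ open p.1, p.1 !=set0, (forall u, p.1 u -> sval s (u i)),
      sval p.2 `<=` sval s &
      forall u x, p.1 u -> sval p.2 x -> e <= `|f u - f (upd i u x)|].
  apply: contrapT => Hs; apply: Hn; exists (sval s); first exact: svalP.
  move=> O W' oO O0 OW FW'; apply: contrapT => Hu; apply: Hs.
  have FI : F (sval s `&` W') by apply: filterI => //; exact: svalP.
  exists (O, exist _ _ FI); split => //= u x Ou [_ W'x].
  by rewrite leNgt; apply/negP => ?; apply: Hu; exists u, x.
have [phi phiP] := choice step.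
pose s k := iter k (fun s => (phi s).2) (exist _ setT (@filterT _ F FF) : sT).
pose O k := (phi (s k)).1.
have oO k : open (O k) by have [] := phiP (s k).
have O0 k : O k !=set0 by have [] := phiP (s k).
have sS k m : (k <= m)%N -> sval (s m) `<=` sval (s k).
  elim: m => [|m IH]; first by rewrite leqn0 => /eqP ->.
  rewrite leq_eqVlt => /predU1P[-> //|/IH]; apply: subset_trans.
  by have [_ _ _ + _] := phiP (s m); apply.
have [z zP] := pseudocompact_cluster crX pcX oO O0.
have [N Nz NA] : exists2 N : 'I_n -> set X, (forall j, nbhs (z j) (N j)) &
    forall w, (forall j, N j (w j)) -> `|f z - f w| < e / 2.
  apply: (@nbhs_powerP _ _ z [set w | `|f z - f w| < e / 2]).
  by have /cvgrPdist_lt := @cf z; apply; rewrite divr_gt0.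
(* Both [u] and [upd i u (v i)] will lie in the box around [z], so [f] differs by less than [e]
   between them; but [u] is in [O k] and [v i] in [s k.+1], which forces a difference of at least
   [e]. *)
have [k _ [u [Nu Ou]]] := zP _ (nbhs_box Nz) 0%N.
have [m km [v [Nv Ov]]] := zP _ (nbhs_box Nz) k.+1.
have vs : sval (s k.+1) (v i).
  by apply: (sS _ _ km); have [_ _ + _ _] := phiP (s m); apply.
have [_ _ _ _ /(_ u (v i) Ou vs)] := phiP (s k).
apply/negP; rewrite -ltNge.
have fu := NA u Nu.
have fv : `|f z - f (upd i u (v i))| < e / 2.
  by apply: NA => j; rewrite /upd; case: eqP => [->|_]; [exact: Nv|exact: Nu].
rewrite -(subrK (f z) (f u)) -addrA (le_lt_trans (ler_normD _ _)) //.
by rewrite distrC [ltRHS]splitr ltrD.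
Qed.

(** Here [oscillation] is applied to the neighbourhood filter of [x]. A difference exceeding [e] at
    one [z] would persist for all points near [z] and all [x'] near [x], whereas [oscillation] finds
    such a pair with difference below [e]. *)
Lemma section_equicontinuous i (x : X) (e : R) : 0 < e ->
  nbhs x [set y | forall z, z i = y -> `|f z - f (upd i z x)| <= e].
Proof.
move=> e0; have [W Wx WP] := @oscillation (nbhs x) i e _ e0.
move: Wx; rewrite nbhsE => -[V [oV Vx] VW]; exists V => //.
move=> y Vy z zy; rewrite leNgt; apply/negP => fz.
pose h (p : power X n * X) := `|f p.1 - f (upd i p.1 p.2)|.
have ch : continuous h.
  move=> p; apply: cvg_norm; apply: cvgB.
    by apply: (@continuous_comp _ _ _ fst f); [exact: cvg_fst|exact: cf].
  apply: (@continuous_comp _ _ _ (fun p => upd i p.1 p.2) f).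
    exact: upd_continuous.
  exact: cf.
have [[/= Q W'] [Qz W'x] QW] := cvgr_gt _ (ch (z, x)) _ fz.
have zO : nbhs z (Q `&` [set u | V (u i)]).
  apply: filterI => //; apply: (@proj_continuous _ (fun=> X) i z).
  by apply: open_nbhs_nbhs; rewrite /proj zy.
move: zO; rewrite nbhsE => -[U [oU Uz] UQ].
have [|u /UQ[_ Vu]|u [x' [ /UQ[Qu _] W'x']]] := WP U W' oU _ _ W'x.
- by exists z.
- exact: VW.
- by apply/negP; rewrite -leNgt ltW //; exact: (QW (u, x')).
Qed.

Hypothesis f01 : forall z, 0 <= f z <= 1.

(** Telescoping in a box whose side [i] is the singleton of [x] moves only the other coordinates, so
    the neighbourhood of [z] does not depend on [x]. *)
Lemma upd_equicontinuous i z (e : R) : 0 < e ->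
  nbhs z [set u | forall x, `|f (upd i z x) - f (upd i u x)| <= e].
Proof.
move=> e0; pose d := e / n.+1%:R / 2.
have d0 : 0 < d by rewrite !divr_gt0 // ltr0n.
pose M j := [set y | forall u, u j = y -> `|f u - f (upd j u (z j))| <= d].
have /nbhs_box : forall j, nbhs (z j) (M j).
  by move=> j; exact: section_equicontinuous.
apply: filterS => u Mu x /=.
apply: le_trans (divr_mulrn_le n (ltW e0)).
apply: (@telescope _ _ _ f (fun j => if j == i then [set x] else M j)).
- move=> j v y /=; case: eqP => [->|_] /=.
    by move=> vx ->; rewrite -vx upd_id subrr normr0 divr_ge0 // ltW.
  move=> Mv My; have := Mv v erefl; have := My (upd j v y) (updE _ _ _).
  rewrite upd_upd => ? ?.
  rewrite -(subrK (f (upd j v (z j))) (f v)) -addrA.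
  apply: le_trans (ler_normD _ _) _.
  by rewrite [leRHS](splitr _) lerD // distrC.
- move=> j; rewrite /upd; case: eqP => //= _ v vz.
  exact: (nbhs_singleton (@section_equicontinuous j (z j) d d0)).
- by move=> j; rewrite /upd; case: eqP => //= _; exact: Mu.
Qed.

(* As [f] has no joint extension to [p] yet, only the sections [f (upd i z _)]
   extend to [p], one [z] at a time; [upd_equicontinuous] lets [z] move in the
   open set to which [oscillation] is applied. *)
Lemma sc_section_oscillation i (p : stone_cech R X) (e : R) : 0 < e ->
  exists2 N, nbhs p N & forall z x, N (eta (z i)) -> N (eta x) ->
    `|f z - f (upd i z x)| <= e.
Proof.
(* [step] is used twice, each time at a cost of [d *+ 5]. *)
move=> e0; pose d := e / 10; have d0 : 0 < d by rewrite divr_gt0.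
pose F : set_system X := filter_from (nbhs p) (fun N => eta @^-1` N).
have FF : Filter F.
  apply: filter_from_filter; first by exists setT; exact: filterT.
  by move=> N M Np Mp; exists (N `&` M) => //; exact: filterI.
have F_ex W : F W -> W !=set0.
  move=> [N Np NW]; have : closure (range eta) p by rewrite sc_unit_dense.
  by move=> /(_ N Np)[_ [[x _ <-] Nx]]; exists x; exact: NW.
have [W [N' N'p N'W] WP] := @oscillation F i d FF d0.
move: N'p; rewrite {1}nbhsE => -[N [oN Np] NN'].
have step z : N (eta (z i)) ->
    exists2 W', F W' & forall x, W' x -> `|f z - f (upd i z x)| <= d *+ 5.
  move=> Nz.
  have ch : continuous (fun x => f (upd i z x)).
    move=> x; apply: (@continuous_comp _ _ _ (upd i z) f); last exact: cf.
    exact: upd_continuousr.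
  have [g cg gE] := sc_extend ch (fun x => f01 _).
  pose W' := [set x | `|g p - f (upd i z x)| < d].
  have FW' : F W'.
    exists [set q | `|g p - g q| < d].
      by have /cvgrPdist_lt := cg p; apply.
    by move=> x; rewrite /W' /= gE.
  (* The five errors come from the path [f z], [f u], [f (upd i u x')], [f (upd i z x')], [g p],
     [f (upd i z x)]. *)
  exists W' => // x W'x.
  have : nbhs z ([set u | `|f z - f u| < d] `&`
      [set u | forall x, `|f (upd i z x) - f (upd i u x)| <= d] `&`
      [set u | N (eta (u i))]).
    apply: filterI; first apply: filterI.
    - by have /cvgrPdist_lt := @cf z; apply.
    - exact: upd_equicontinuous.
    - apply: (@proj_continuous _ (fun=> X) i z (eta @^-1` N)).
      by apply: sc_unit_continuous; exact: open_nbhs_nbhs.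
  rewrite nbhsE => -[U [oU Uz] US].
  have [|u /US[_ Nu]|u [x' [ /US[[fu fux] _] W'x' fx']]] := WP U W' oU _ _ FW'.
  - by exists z.
  - by apply: N'W; exact: NN'.
  have := fux x'; move: fu fx' W'x W'x'; rewrite /W' /=.
  rewrite !mulrS mulr0n; do !(rewrite ltr_norml => /andP[? ?]).
  by rewrite !ler_norml => /andP[? ?]; apply/andP; split; lra.
exists N; first exact: (open_nbhs_nbhs (conj oN Np)).
move=> z x Nz Nx; have [W1 FW1 HW1] := step z Nz.
have [|W2 FW2 HW2] := step (upd i z x); first by rewrite updE.
(* The points [z] and [upd i z x] become equal once their coordinate [i] is replaced by a common
   [y]. *)
have [y [W1y W2y]] := F_ex _ (filterI FW1 FW2).
have := HW1 y W1y; have := HW2 y W2y; rewrite upd_upd !mulrS mulr0n /d.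
by rewrite !ler_norml => /andP[? ?] /andP[? ?]; apply/andP; split; lra.
Qed.

Lemma sc_power_oscillation (P : power (stone_cech R X) n) (e : R) : 0 < e ->
  exists2 N, nbhs P N & forall z w, N (eta \o z) -> N (eta \o w) ->
    `|f z - f w| <= e.
Proof.
move=> e0; have d0 : 0 < e / n.+1%:R by rewrite divr_gt0 // ltr0n.
have H i : exists N, nbhs (P i) N /\ forall z x, N (eta (z i)) -> N (eta x) ->
    `|f z - f (upd i z x)| <= e / n.+1%:R.
  by have [N ? ?] := sc_section_oscillation i (P i) d0; exists N.
have [N NP] := choice H.
exists [set Q : power (stone_cech R X) n | forall i, N i (Q i)].
  by apply: nbhs_box => i; have [] := NP i.
move=> z w Nz Nw; apply: le_trans (divr_mulrn_le n (ltW e0)).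
apply: (@telescope _ _ _ f (fun i => eta @^-1` N i)) => // i z' x.
by have [_ +] := NP i; apply.
Qed.

End Oscillation.

(** * Continuous extension from a dense subset *)

Lemma dense_extension (R : realType) (D : Type) (Z : topologicalType)
    (j : D -> Z) (f : D -> R) :
  closure (range j) = [set: Z] ->
  (forall (z : Z) (e : R), 0 < e -> exists2 N : set Z, nbhs z N &
    forall d d', N (j d) -> N (j d') -> `|f d - f d'| <= e) ->
  exists2 g : Z -> R, continuous g & forall d, g (j d) = f d.
Proof.
move=> dj fosc.
have j_ex (z : Z) N : nbhs z N -> exists d, N (j d).
  move=> Nz; have : closure (range j) z by rewrite dj.
  by move=> /(_ N Nz)[_ [[d _ <-] Nd]]; exists d.
have lim (z : Z) : exists l : R, forall e, 0 < e ->
    exists2 N : set Z, nbhs z N & forall d, N (j d) -> `|f d - l| <= e.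
  (* Density makes this filter proper and small oscillation makes it Cauchy; its limit is the value
     at [z]. *)
  pose F : set_system R := filter_from (nbhs z) (fun N => f @` (j @^-1` N)).
  have FF : ProperFilter F.
    apply: filter_from_proper; last first.
      by move=> N /(j_ex z)[d Nd]; exists (f d), d.
    apply: filter_from_filter; first by exists setT; exact: filterT.
    move=> N M Nz Mz; exists (N `&` M); first exact: filterI.
    by move=> _ [d [Nd Md] <-]; split; exists d.
  have /cauchy_cvg cF : cauchy F.
    apply: cauchy_exP => e e0.
    have e20 : 0 < e / 2 by rewrite divr_gt0.
    have [N Nz NP] := fosc z _ e20; have [d Nd] := j_ex _ _ Nz.
    exists (f d), N => // _ [d' Nd' <-]; rewrite /ball /=.
    apply: le_lt_trans (NP _ _ Nd Nd') _.
    by rewrite ltr_pdivrMr // ltr_pMr // ltr1n.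
  exists (lim F) => e e0.
  have [N Nz NP] := cF _ (nbhsx_ballx (lim F) e e0).
  exists N => // d Nd; rewrite distrC ltW //.
  by apply: NP; exists d.
have [g gP] := choice lim; exists g.
  move=> z; apply/cvgrPdist_lt => e e0.
  have e40 : 0 < e / 4 by rewrite divr_gt0.
  have [N] := gP z _ e40; rewrite {1}nbhsE => -[U [oU Uz] UN] NP.
  apply: filterS (open_nbhs_nbhs (conj oU Uz)) => y Uy.
  have [M My MP] := gP y _ e40.
  have [d [Ud Md]] := j_ex y _ (filterI (open_nbhs_nbhs (conj oU Uy)) My).
  have := NP d (UN _ Ud); have := MP d Md.
  rewrite !ler_norml /= ltr_norml => /andP[? ?] /andP[? ?].
  by apply/andP; split; lra.
move=> d; apply/eqP; rewrite eq_sym -subr_eq0 -normr_le0.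
apply/ler_addgt0Pr => e e0.
by have [N /nbhs_singleton Nd NP] := gP (j d) _ e0; rewrite add0r NP.
Qed.

(** Each coordinate of the cube extends separately; by density the resulting map into the cube stays
    in the closure of the image of [X]. *)
Lemma stone_cech_dense_extension (R : realType) (D : Type)
    (X Z : topologicalType) (j : D -> Z) (phi : D -> X) :
  closure (range j) = [set: Z] ->
  (forall u : X -> R, continuous u -> (forall x, 0 <= u x <= 1) ->
    forall (z : Z) (e : R), 0 < e -> exists2 N : set Z, nbhs z N &
      forall d d', N (j d) -> N (j d') -> `|u (phi d) - u (phi d')| <= e) ->
  exists2 Phi : Z -> stone_cech R X, continuous Phi &
    forall d, Phi (j d) = sc_unit R (phi d).
Proof.
move=> dj osc.
have ext (i : unit_functions R X) : exists g : Z -> R,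
    continuous g /\ forall d, g (j d) = set_val i (phi d).
  have [ci i01] := set_valP i.
  by have [g cg gE] := dense_extension dj (osc _ ci i01); exists g.
have [g gP] := choice ext.
pose G z : sc_cube R X := fun i => g i z.
have cG : continuous G by apply: ptws_continuous => i; have [] := gP i.
have GE d : G (j d) = @sc_eval R X (phi d).
  by apply/funext => i; rewrite /G; have [_ ->] := gP i.
have Gcl z : G z \in closure (range (@sc_eval R X)).
  apply/mem_set => V /cG GV; have : closure (range j) z by rewrite dj.
  move=> /(_ _ GV)[_ [[d _ <-] /= Vd]].
  by exists (G (j d)); split => //; rewrite GE; exists (phi d).
exists (fun z => exist _ (G z) (Gcl z)); first exact: continuous_comp_initial.
by move=> d; apply: val_inj; rewrite /= GE.
Qed.

(** * C-pairs and functions on a clopen piece of the signature *)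

Lemma C_pair_equicontinuous (R : realType) (S T : topologicalType)
    (h : S * T -> R) (t : T) (e : R) :
  C_pair R S T -> continuous h -> 0 < e ->
  nbhs t [set t' | forall s, `|h (s, t') - h (s, t)| <= e].
Proof.
move=> CST ch e0; have [g cg gE] := CST h ch.
(* Compactness turns neighbourhoods of [t] depending on the point [q] into a single one, as in the
   tube lemma. *)
have /compact_near_coveringP cov := @stone_cech_compact R S.
have := cov _ (nbhs t) (fun t' q => `|g (q, t') - g (q, t)| < e) _ _.
have H q : [set: stone_cech R S] q ->
    \forall q' \near q & t' \near t, `|g (q', t') - g (q', t)| < e.
  move=> _; have e20 : 0 < e / 2 by rewrite divr_gt0.
  have /cvgrPdist_lt/(_ _ e20)[[/= A B] [Aq Bt] AB] := cg (q, t).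
  exists (A, B) => // -[q' t'] [/= Aq' Bt'].
  have := AB (q', t') (conj Aq' Bt').
  have := AB (q', t) (conj Aq' (nbhs_singleton Bt)).
  rewrite /= !ltr_norml => /andP[? ?] /andP[? ?]; apply/andP; split; lra.
move=> /(_ _ H); apply: filterS => t' Ht' s.
by rewrite -!gE ltW // Ht'.
Qed.

Section Signature.
Variables (R : realType) (E X : topologicalType) (A : set E) (n : nat).
Hypothesis clopenA : clopen A.
Variable f : set_type A * power X n -> R.
Hypothesis cf : continuous f.

(* The factors are swapped because [C_pair] puts the pseudocompact one first. *)
Definition extend0 (p : power X n * E) : R :=
  match pselect (A p.2) with
  | left Aa => f (exist _ p.2 (mem_set Aa), p.1)
  | right _ => 0
  end.

Lemma extend0E z (a : set_type A) : extend0 (z, val a) = f (a, z).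
Proof.
rewrite /extend0 /=; case: pselect => [Aa|]; last by case; exact: set_valP.
by congr (f (_, z)); exact: val_inj.
Qed.

(** Openness of [A] gives continuity over [A]; closedness makes the function locally zero
    elsewhere. *)
Lemma extend0_continuous : continuous extend0.
Proof.
move=> [z a] V; have [oA cA] := clopenA; have [Aa|nAa] := pselect (A a).
  pose a' : set_type A := exist _ a (mem_set Aa).
  rewrite -[a]/(val a') extend0E => /cf [[/= M B] [Ma Bz] MB].
  move: Ma; rewrite {1}nbhsE => -[_ [[U oU <-] Ua] UM].
  exists (B, U `&` A).
    by split=> //=; apply: open_nbhs_nbhs; split; [exact: openI|].
  move=> [z' b] [/= Bz' [Ub Ab]].
  pose b' : set_type A := exist _ b (mem_set Ab).
  rewrite /= -[b]/(val b') extend0E; apply: MB; split => //=.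
  exact: UM.
have E0 z' b : ~ A b -> extend0 (z', b) = 0.
  by move=> nAb; rewrite /extend0; case: pselect.
rewrite E0 // => V0; exists (setT, ~` A).
  split=> /=; first exact: filterT.
  by apply: open_nbhs_nbhs; split => //; exact: closed_openC.
by move=> [z' b] [/= _ nAb]; rewrite /= E0 //; exact: nbhs_singleton.
Qed.

End Signature.

(** * Extension of the operations *)

Lemma dense_unit_power (R : realType) (T X : topologicalType) (n : nat) :
  closure (range (fun d : T * power X n =>
    (d.1, @sc_unit R X \o d.2 : power (stone_cech R X) n))) = setT.
Proof.
apply/seteqP; split => // -[a P] _ N [[/= M B] [Ma BP] MB].
have [V VP VB] := nbhs_powerP BP.
have H i : exists x, V i (sc_unit R x).
  have : closure (range (@sc_unit R X)) (P i) by rewrite sc_unit_dense.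
  by move=> /(_ _ (VP i))[_ [[x _ <-] Vx]]; exists x.
have [x xV] := choice H.
exists (a, @sc_unit R X \o x); split; first by exists (a, x).
by apply: MB; split => /=; [exact: nbhs_singleton|exact: VB].
Qed.

Theorem theorem6 (R : realType) (E X : topologicalType) (En : nat -> set E)
    (e : algebra_operations En X)
    (tychonoffE : tychonoff_space E) (tychonoffX : tychonoff_space X)
    (signatureE : continuous_signature En)
    (algebraX : topological_algebra e)
    (universalE : C_universal R E)
    (pseudocompactX : forall n, Sp En n -> pseudocompact_space R (power X n)) :
  exists2 eb : algebra_operations En (stone_cech R X),
    topological_algebra eb & extends_operations (@sc_unit R X) e eb.
Proof.
have [clopenEn _ _] := signatureE.
suff H n : exists ebn : set_type (En n) * power (stone_cech R X) n ->
    stone_cech R X, continuous ebn /\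
    forall a x, ebn (a, @sc_unit R X \o x) = sc_unit R (e n (a, x)).
  exists (fun n => projT1 (cid (H n))).
    by move=> n; have [] := projT2 (cid (H n)).
  by move=> n a x; have [_ ->] := projT2 (cid (H n)).
(* Pseudocompactness of the power is known only for [n] in [Sp En]; otherwise the domain of the
   operation is empty. *)
have [En0|noEn] := pselect (Sp En n); last first.
  have F (p : set_type (En n) * power (stone_cech R X) n) : False.
    by apply: noEn; exists (val p.1); exact: set_valP.
  by exists (fun p => False_rect _ (F p)); split => [p|a x];
    [case: (F p)|case: (F (a, @sc_unit R X \o x))].
have tyP := @power_tychonoff R X n tychonoffX.
have pcP := pseudocompactX n En0.
have [|ebn cebn ebnE] := @stone_cech_dense_extension R _ X _ _ (e n)
    (@dense_unit_power R (set_type (En n)) X n); last first.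
  exists ebn; split => // a x; exact: (ebnE (a, x)).
move=> u cu u01 [a P] d d0.
pose f p := u (e n p).
have cf : continuous f.
  by move=> p; apply: continuous_comp; [exact: algebraX|exact: cu].
have d40 : 0 < d / 4 by rewrite divr_gt0.
have cfa : continuous (fun z => f (a, z)).
  move=> z; apply: (@continuous_comp _ _ _ (fun z => (a, z)) f); last exact: cf.
  move=> V [[/= M B] [Ma Bz] MB]; apply: filterS Bz => w Bw.
  by apply: MB; split => //=; exact: nbhs_singleton.
have [N NP osc] := @sc_power_oscillation R X n (fun z => f (a, z)) tyP.2 pcP
  cfa (fun z => u01 _) P _ d40.
(* Values at [(b, z)] and [(b', z')] are compared through [(a, z)] and [(a, z')]: three errors of at
   most [d / 4]. *)
pose M : set (set_type (En n)) :=
  [set b | forall z, `|f (b, z) - f (a, z)| <= d / 4].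
have Ma : nbhs a M.
  have := C_pair_equicontinuous (val a) (universalE _ tyP pcP)
    (extend0_continuous (clopenEn n) cf) d40.
  move=> /(@initial_continuous _ _ (set_val : set_type (En n) -> E) a).
  rewrite nbhs_simpl /=; apply: filterS => b Hb z.
  by have := Hb z; rewrite !extend0E.
exists (M `*` N); first by exists (M, N).
move=> [b z] [b' z'] [/= Hb Nz] [/= Hb' Nz'].
have := Hb z; have := Hb' z'; have := osc _ _ Nz Nz'; rewrite /f !ler_norml.
by move=> /andP[? ?] /andP[? ?] /andP[? ?]; apply/andP; split; lra.
Qed.
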